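(* For each of the three variants of the family $TD_r:\mathbf{Met}\to\mathbf{Met}$ ($r\in[0,\infty]$) given in the context (worst-case, best-case, expected-value), the maps $\eta_X$ and $\mu_X$ given in the context make $TD_r$ into an $\mathcal R$-graded monad on $\mathbf{Met}$, where $\mathcal R=[0,\infty]$ is the pre-ordered monoid of extended non-negative reals with the usual order and addition.
   Context: $\mathbf{Met}$ is the category of extended pseudo-metric spaces (sets $A$ with $d_A:A\times A\to[0,\infty]$ satisfying $d(a,a)=0$, symmetry and the triangle inequality) and non-expansive maps. $D$ is the finite distribution monad on sets: $DX$ is the set of finitely supported probability distributions on $X$, $\tilde\eta_X(x)$ is the point distribution at $x$, $\tilde\mu_X:D(DX)\to DX$ flattens (averages) a distribution over distributions, and $D(f)$ is pushforward. For a metric space $(X,d_X)$, $TD_rX$ is a subset of $X\times DX$ with metric $d((x,p),(y,p'))=d_X(x,y)$; the three variants are: 1. (worst-case) $(x,p)\in TD_rX$ iff $d_X(x,a)\le r$ for all $a$ in the support of $p$; 2. (best-case) $(x,p)\in TD_rX$ iff $d_X(x,a)\le r$ for some $a$ in the support of $p$; 3. (expected-value) $(x,p)\in TD_rX$ iff the expected value of $d_X(x,a)$, for $a$ drawn from $p$, is at most $r$. A morphism $f:X\to Y$ acts by $(x,p)\mapsto(f(x),D(f)(p))$. For $q\le r$ the map $(q\le r)$ is the inclusion. $\eta_X:X\to TD_0X$ is $\eta_X(x)=(x,\tilde\eta_X(x))$, and $\mu_X=\mu_{q,r,X}:TD_q(TD_rX)\to TD_{q+r}X$ is $\mu_X((x,p'),p)=(x,\tilde\mu_X(D(\pi_2)(p)))$,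 where $p\in D(TD_rX)$ and $\pi_2:TD_rX\to DX$ is the second projection. **Graded monad.** An $\mathcal R$-graded monad on a category consists of endofunctors $T_r$ ($r\in\mathcal R$), natural transformations $(q\le r):T_q\to T_r$ for $q\le r$ (functorial in the order), $\eta:\mathrm{Id}\to T_0$, and $\mu_{q,r}:T_qT_r\to T_{q+r}$ (compatible with the maps $(q\le r)$ in both indices), such that for all objects $A$: $\mu_{0,r,A}\circ\eta_{T_rA}=\mathrm{id}_{T_rA}=\mu_{r,0,A}\circ T_r\eta_A$ and $\mu_{p,q+r,A}\circ T_p\mu_{q,r,A}=\mu_{p+q,r,A}\circ\mu_{p,q,T_rA}$. *)

(* Defs.v *)
From HB Require Import structures.
From mathcomp Require Import all_boot all_order all_algebra.
From mathcomp Require Import all_classical all_reals ereal.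

Set Implicit Arguments.
Unset Strict Implicit.
Unset Printing Implicit Defensive.

Import Order.TTheory GRing.Theory Num.Theory.

Local Open Scope classical_set_scope.
Local Open Scope ring_scope.

Declare Scope cat_scope.
Delimit Scope cat_scope with cat.

Record category := Category {
  ob :> Type;
  hom : ob -> ob -> Type;
  idm : forall a, hom a a;
  comp : forall a b c, hom b c -> hom a b -> hom a c;
  comp_idl : forall a b (f : hom a b), comp (idm b) f = f;
  comp_idr : forall a b (f : hom a b), comp f (idm a) = f;
  compA : forall a b c d (h : hom c d) (g : hom b c) (f : hom a b),
    comp h (comp g f) = comp (comp h g) f
}.

Arguments hom {_} _ _.
Arguments idm {_} _.
Arguments comp {_} {_ _ _} _ _.
Notation "g \o f" := (comp g f) : cat_scope.

Record functor (C D : category) := Functor {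
  fobj :> C -> D;
  fmap : forall a b, hom a b -> hom (fobj a) (fobj b);
  fmap_id : forall a, fmap (idm a) = idm (fobj a);
  fmap_comp : forall a b c (g : hom b c) (f : hom a b),
    fmap (g \o f)%cat = (fmap g \o fmap f)%cat
}.

Arguments fmap {C D} _ {a b} _.

Definition functor_id (C : category) : functor C C :=
  @Functor C C (fun a => a) (fun _ _ f => f)
    (fun _ => erefl) (fun _ _ _ _ _ => erefl).

Section FunctorComp.
Variables (C D E : category) (G : functor D E) (F : functor C D).

Let fmap_comp_id a : fmap G (fmap F (idm a)) = idm (G (F a)).
Proof. by rewrite !fmap_id. Qed.

Let fmap_comp_comp a b c (g : hom b c) (f : hom a b) :
  fmap G (fmap F (g \o f)%cat) =
  (fmap G (fmap F g) \o fmap G (fmap F f))%cat.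
Proof. by rewrite !fmap_comp. Qed.

Definition functor_comp : functor C E :=
  @Functor C E (fun a => G (F a)) (fun _ _ f => fmap G (fmap F f))
    fmap_comp_id fmap_comp_comp.

End FunctorComp.

Record nat_trans (C D : category) (F G : functor C D) := NatTrans {
  nt_mor :> forall a, hom (F a) (G a);
  nt_natural : forall a b (f : hom a b),
    (nt_mor b \o fmap F f = fmap G f \o nt_mor a)%cat
}.

Record preord_monoid := PreordMonoid {
  pm_sort :> Type;
  pm_le : rel pm_sort;
  pm_zero : pm_sort;
  pm_add : pm_sort -> pm_sort -> pm_sort;
  pm_le_refl : reflexive pm_le;
  pm_le_trans : transitive pm_le;
  pm_addA : associative pm_add;
  pm_add0l : left_id pm_zero pm_add;
  pm_add0r : right_id pm_zero pm_add;
  pm_le_add : forall q q' r r',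
    pm_le q q' -> pm_le r r' -> pm_le (pm_add q r) (pm_add q' r')
}.

Arguments pm_le {p} _ _.
Arguments pm_zero {p}.
Arguments pm_add {p} _ _.

(** The laws of a graded monad identify, e.g., [T (0 + r) A] with [T r A]. Since
    the grades are only propositionally equal, this identification is the
    transport of the identity morphism. *)
Definition grade_cast (G : Type) (C : category) (T : G -> functor C C)
    (q r : G) (e : q = r) (A : C) : hom (T q A) (T r A) :=
  match e in _ = s return hom (T q A) (T s A) with erefl => idm (T q A) end.

Arguments grade_cast {G C} T {q r} e A.

Record graded_monad (G : preord_monoid) (C : category)
    (T : G -> functor C C) := GradedMonad {
  gm_sub : forall q r : G, pm_le q r -> nat_trans (T q) (T r);
  gm_eta : nat_trans (functor_id C) (T pm_zero);
  gm_mu : forall q r : G,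
    nat_trans (functor_comp (T q) (T r)) (T (pm_add q r));
  gm_sub_refl : forall (q : G) (h : pm_le q q) A, gm_sub h A = idm (T q A);
  gm_sub_trans : forall (p q r : G)
      (hpq : pm_le p q) (hqr : pm_le q r) (hpr : pm_le p r) A,
    (gm_sub hqr A \o gm_sub hpq A = gm_sub hpr A)%cat;
  gm_mu_sub : forall (q q' r r' : G) (hq : pm_le q q') (hr : pm_le r r') A,
    (gm_mu q' r' A \o (gm_sub hq (T r' A) \o fmap (T q) (gm_sub hr A)) =
     gm_sub (pm_le_add hq hr) A \o gm_mu q r A)%cat;
  gm_mu_eta_l : forall (r : G) A,
    (grade_cast T (pm_add0l r) A \o (gm_mu pm_zero r A \o gm_eta (T r A)) =
     idm (T r A))%cat;
  gm_mu_eta_r : forall (r : G) A,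
    (grade_cast T (pm_add0r r) A \o (gm_mu r pm_zero A \o fmap (T r) (gm_eta A))
     = idm (T r A))%cat;
  gm_mu_assoc : forall (p q r : G) A,
    (grade_cast T (pm_addA p q r) A \o
       (gm_mu p (pm_add q r) A \o fmap (T p) (gm_mu q r A)) =
     gm_mu (pm_add p q) r A \o gm_mu p q (T r A))%cat
}.

Arguments gm_sub {G C T} _ {q r} _.
Arguments gm_eta {G C T} _.
Arguments gm_mu {G C T} _ q r.

Section ExtNonneg.
Variable R : realType.

Definition ennreal := {x : \bar R | (0 <= x)%E}.

Definition ennreal_le : rel ennreal := fun q r => (val q <= val r)%E.

Definition ennreal_zero : ennreal := exist _ 0%E (lexx 0%E).

Definition ennreal_add (q r : ennreal) : ennreal :=
  exist _ (val q + val r)%E (adde_ge0 (valP q) (valP r)).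

Let ennreal_le_refl : reflexive ennreal_le.
Proof. by move=> q; exact: lexx. Qed.

Let ennreal_le_trans : transitive ennreal_le.
Proof. by move=> r q s; exact: le_trans. Qed.

Let ennreal_addA : associative ennreal_add.
Proof. by move=> q r s; apply: val_inj; rewrite /= addeA. Qed.

Let ennreal_add0l : left_id ennreal_zero ennreal_add.
Proof. by move=> q; apply: val_inj; rewrite /= add0e. Qed.

Let ennreal_add0r : right_id ennreal_zero ennreal_add.
Proof. by move=> q; apply: val_inj; rewrite /= adde0. Qed.

Let ennreal_le_add q q' r r' : ennreal_le q q' -> ennreal_le r r' ->
  ennreal_le (ennreal_add q r) (ennreal_add q' r').
Proof. exact: leeD. Qed.

Definition ennreal_monoid : preord_monoid :=
  PreordMonoid ennreal_le_refl ennreal_le_trans ennreal_addA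
    ennreal_add0l ennreal_add0r ennreal_le_add.

End ExtNonneg.

Record epmet (R : realType) := EPMet {
  carrier :> Type;
  dist : carrier -> carrier -> \bar R;
  dist_ge0 : forall x y, (0 <= dist x y)%E;
  dist_refl : forall x, dist x x = 0%E;
  dist_sym : forall x y, dist x y = dist y x;
  dist_triangle : forall x y z, (dist x z <= dist x y + dist y z)%E
}.

Arguments dist {R e} _ _.

Record nonexp (R : realType) (X Y : epmet R) := NonExp {
  nx_fun :> X -> Y;
  nx_le : forall x y, (dist (nx_fun x) (nx_fun y) <= dist x y)%E
}.

Lemma nonexp_eq (R : realType) (X Y : epmet R) (f g : nonexp X Y) :
  (forall x, f x = g x) -> f = g.
Proof.
case: f g => [f hf] [g hg] /= /funext fg; case: _ / fg hg => hg.
by congr NonExp; exact: Prop_irrelevance.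
Qed.

Section Met.
Variable R : realType.

Definition nonexp_id (X : epmet R) : nonexp X X :=
  @NonExp R X X (fun x => x) (fun x y => lexx (dist x y)).

Definition nonexp_comp (X Y Z : epmet R) (g : nonexp Y Z) (f : nonexp X Y) :
    nonexp X Z :=
  @NonExp R X Z (fun x => g (f x))
    (fun x y => le_trans (nx_le g (f x) (f y)) (nx_le f x y)).

Let nonexp_idl X Y (f : nonexp X Y) : nonexp_comp (nonexp_id Y) f = f.
Proof. exact: nonexp_eq. Qed.

Let nonexp_idr X Y (f : nonexp X Y) : nonexp_comp f (nonexp_id X) = f.
Proof. exact: nonexp_eq. Qed.

Let nonexp_compA X Y Z W (h : nonexp Z W) (g : nonexp Y Z) (f : nonexp X Y) :
  nonexp_comp h (nonexp_comp g f) = nonexp_comp (nonexp_comp h g) f.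
Proof. exact: nonexp_eq. Qed.

Definition Met : category :=
  @Category (epmet R) (@nonexp R) nonexp_id nonexp_comp
    nonexp_idl nonexp_idr nonexp_compA.

End Met.

(** Summing over [{classic X}] equips an arbitrary type [X] with the choice
    structure that the library asks of the index type of a finitely supported
    sum. *)
Record fdist (R : realType) (X : Type) := FDist {
  fd_mass :> X -> R;
  fd_ge0 : forall x, 0 <= fd_mass x;
  fd_finite : finite_set [set x | fd_mass x != 0];
  fd_sum1 : \sum_(x \in [set: {classic X}]) fd_mass x = 1
}.

Lemma fdist_eq (R : realType) (X : Type) (p q : fdist R X) :
  (forall x, p x = q x) -> p = q.
Proof.
case: p q => [p p0 pf p1] [q q0 qf q1] /= /funext pq.
case: _ / pq q0 qf q1 => q0 qf q1.
by congr FDist; exact: Prop_irrelevance.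
Qed.

Lemma fsbig_fibers (S : Type) (idx : S) (op : Monoid.com_law idx)
    (I J : choiceType) (f : I -> J) (B : set J) (F : I -> S) :
  finite_set [set i | F i <> idx] ->
  \big[op/idx]_(j \in B) \big[op/idx]_(i \in f @^-1` [set j]) F i =
  \big[op/idx]_(i \in f @^-1` B) F i.
Proof.
set A := [set i | _] => Afin.
have Bfin : finite_set (B `&` f @` A) by apply: finite_setIr; exact: finite_image.
rewrite -(fsbig_widen (B `&` f @` A)); last 2 first.
- by move=> j [].
- move=> j [Bj /= nAj]; apply: fsbig1 => i /= fij.
  by apply: contrapT => Fi; apply: nAj; split=> //; exists i.
have fiber j : \big[op/idx]_(i \in f @^-1` [set j]) F i =
    \big[op/idx]_(i \in A) (if f i == j then F i else idx).
  rewrite fsbig_mkcond; rewrite [RHS]fsbig_mkcond; apply: eq_fsbigr => i _.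
  have -> : patch (fun=> idx) (f @^-1` [set j]) F i =
      if f i == j then F i else idx.
    rewrite /patch; congr (if _ then _ else _).
    by apply/idP/eqP; rewrite inE.
  rewrite /patch; case: (boolP (i \in A)) => //.
  by rewrite notin_setE /A /= => /contrapT ->; case: ifP.
under eq_fsbigr do rewrite fiber.
rewrite exchange_fsbig // fsbig_mkcond [RHS]fsbig_mkcond.
apply: eq_fsbigr => i _; rewrite /patch.
case: (boolP (i \in A)) => [|]; last first.
  by rewrite notin_setE /A /= => /contrapT ->; case: ifP.
rewrite inE => Ai; case: (boolP (i \in _)) => [|]; rewrite ?inE ?notin_setE /=.
  move=> Bfi; rewrite -(fsbig_widen [set f i]).
  - by rewrite fsbig_set1 eqxx.
  - by move=> _ ->; split=> //; exists i.
  - by move=> j [_ /= fij]; case: eqP => // /esym.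
move=> nBfi; apply: fsbig1 => j [Bj _].
by case: eqP => // fij; rewrite -fij in Bj.
Qed.

Section FDist.
Variable R : realType.

Lemma fd_finite_mul (X : Type) (p : fdist R X) (F : X -> \bar R) :
  finite_set [set x | ((p x)%:E * F x)%E <> 0%E].
Proof.
apply: sub_finite_set (fd_finite p) => x /= px.
by apply: contra_not_neq px => ->; rewrite mul0e.
Qed.

Section Unit.
Variables (X : Type) (x : X).

Definition unit_mass (y : X) : R := (y == x :> {classic X})%:R.

Let unit_ge0 y : 0 <= unit_mass y. Proof. exact: ler0n. Qed.

Let unit_finite : finite_set [set y | unit_mass y != 0].
Proof.
apply: sub_finite_set (finite_set1 x) => y /=; apply: contra_neqP => yx.
by rewrite /unit_mass; case: eqP.
Qed.

Let unit_sum1 : \sum_(y \in [set: {classic X}]) unit_mass y = 1.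
Proof.
rewrite -(fsbig_widen [set (x : {classic X})]) //.
  by rewrite fsbig_set1 /unit_mass eqxx.
by move=> y [_ /= yx]; rewrite /unit_mass; case: eqP.
Qed.

Definition fd_unit : fdist R X := FDist unit_ge0 unit_finite unit_sum1.

End Unit.

Section Map.
Variables (X Y : Type) (f : X -> Y) (p : fdist R X).

Definition map_mass (y : Y) : R :=
  \sum_(x \in (f @^-1` [set y] : set {classic X})) p x.

Let map_ge0 y : 0 <= map_mass y.
Proof. by apply: fsumr_ge0 => x _; exact: fd_ge0. Qed.

Let map_finite : finite_set [set y | map_mass y != 0].
Proof.
apply: sub_finite_set (finite_image f (fd_finite p)) => y /=.
apply: contra_neqP => nfy; apply: fsbig1 => x /= fxy.
by apply: contrapT => /eqP px; apply: nfy; exists x.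
Qed.

Let map_sum1 : \sum_(y \in [set: {classic Y}]) map_mass y = 1.
Proof.
rewrite -(fd_sum1 p).
rewrite (@fsbig_fibers _ _ _ {classic X} {classic Y} f setT p) //.
by apply: sub_finite_set (fd_finite p) => x /= /eqP.
Qed.

Definition fd_map : fdist R Y := FDist map_ge0 map_finite map_sum1.

End Map.

Section Join.
Variables (X : Type) (P : fdist R (fdist R X)).

Definition join_mass (x : X) : R :=
  \sum_(p \in [set: {classic fdist R X}]) P p * (p : fdist R X) x.

Let join_ge0 x : 0 <= join_mass x.
Proof. by apply: fsumr_ge0 => p _; rewrite mulr_ge0 ?fd_ge0. Qed.

Let support : set {classic X} :=
  \bigcup_(p in [set p | P p != 0]) [set x | p x != 0].

Let support_finite : finite_set support.
Proof.
by apply: bigcup_finite => [|p _]; [exact: fd_finite|exact: fd_finite].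
Qed.

Let join_finite : finite_set [set x | join_mass x != 0].
Proof.
apply: sub_finite_set support_finite => x /=.
apply: contra_neqP => nx; apply: fsbig1 => p _.
apply/eqP; rewrite mulf_eq0; apply: contrapT => /negP.
by rewrite negb_or => /andP[Pp px]; apply: nx; exists p.
Qed.

Let join_sum1 : \sum_(x \in [set: {classic X}]) join_mass x = 1.
Proof.
pose SP : set {classic fdist R X} := [set p | P p != 0].
have SPfin : finite_set SP by exact: fd_finite.
rewrite -(fsbig_widen support); last 2 first.
- by [].
- move=> x [_ nx]; apply: contrapT => /eqP; apply/negP.
  rewrite negbK; apply/eqP; apply: fsbig1 => p _; apply/eqP.
  rewrite mulf_eq0; apply: contrapT => /negP.
  by rewrite negb_or => /andP[Pp px]; apply: nx; exists p.
under eq_fsbigr => x _.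
  rewrite /join_mass -(fsbig_widen SP) //; last first.
    by move=> p [_ /= /negP]; rewrite negbK => /eqP ->; rewrite mul0r.
  over.
rewrite exchange_fsbig // -(fd_sum1 P).
rewrite -[RHS](fsbig_widen SP) //; last first.
  by move=> p [_ /= /negP]; rewrite negbK => /eqP ->.
apply: eq_fsbigr => p; rewrite inE /= => Pp.
rewrite -mulr_fsumr -[RHS]mulr1 -(fd_sum1 p); congr (_ * _).
apply: fsbig_widen => // x [_ nx]; apply: contrapT => /eqP px.
by apply: nx; exists p.
Qed.

Definition fd_join : fdist R X := FDist join_ge0 join_finite join_sum1.

End Join.

Lemma fd_map_id (X : Type) (p : fdist R X) : fd_map (fun x => x) p = p.
Proof.
apply: fdist_eq => x; rewrite /= /map_mass.
exact: (@fsbig_set1 _ _ _ {classic X}).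
Qed.

Lemma fd_map_comp (X Y Z : Type) (g : Y -> Z) (f : X -> Y) (p : fdist R X) :
  fd_map (fun x => g (f x)) p = fd_map g (fd_map f p).
Proof.
apply: fdist_eq => z; rewrite /= /map_mass /=.
rewrite (@fsbig_fibers _ _ _ {classic X} {classic Y} f _ p) //.
by apply: sub_finite_set (fd_finite p) => x /= /eqP.
Qed.

(** Since [0 * +oo = 0] in [\bar R], only the support of [p] contributes. *)
Definition fd_expect (X : Type) (p : fdist R X) (F : X -> \bar R) : \bar R :=
  (\sum_(x \in [set: {classic X}]) (p x)%:E * F x)%E.

Lemma fd_expect_map (X Y : Type) (f : X -> Y) (p : fdist R X) (F : Y -> \bar R) :
  (forall y, (0 <= F y)%E) ->
  fd_expect (fd_map f p) F = fd_expect p (fun x => F (f x)).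
Proof.
move=> F0; rewrite /fd_expect.
rewrite -(@fsbig_fibers _ _ _ {classic X} {classic Y} f setT
  (fun x => ((p x)%:E * F (f x))%E)); last exact: fd_finite_mul.
apply: eq_fsbigr => y _ /=; rewrite /map_mass.
set A := (f @^-1` _ : set {classic X}).
transitivity (\sum_(x \in A) (p x)%:E * F y)%E; last first.
  by apply: eq_fsbigr => x; rewrite inE => /= ->.
pose Sp : set {classic X} := [set x | p x != 0].
have Afin : finite_set (A `&` Sp) by apply: finite_setIr; exact: fd_finite.
have sum_supp (S : Type) (z : S) (op : Monoid.com_law z) (h : {classic X} -> S) :
    (forall x, p x = 0 -> h x = z) ->
    \big[op/z]_(x \in A) h x = \big[op/z]_(x \in A `&` Sp) h x.
  move=> h0; apply/esym/fsbig_widen => [x []//|x [Ax nx]] /=.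
  by apply: h0; apply: contrapT => /eqP px; apply: nx.
rewrite [in LHS]sum_supp // [RHS]sum_supp; last by move=> x ->; rewrite mul0e.
rewrite -fsumEFin // ge0_mule_fsuml // => x.
by rewrite lee_fin fd_ge0.
Qed.

End FDist.

Variant TD_variant := WorstCase | BestCase | ExpectedValue.

Section TD.
Variables (R : realType) (v : TD_variant).

Definition TD_mem (r : ennreal R) (X : epmet R) (x : X) (p : fdist R X) : Prop :=
  match v with
  | WorstCase => forall a, p a != 0 -> (dist x a <= val r)%E
  | BestCase => exists a, p a != 0 /\ (dist x a <= val r)%E
  | ExpectedValue => (fd_expect p (dist x) <= val r)%E
  end.

Definition TD_carrier (r : ennreal R) (X : epmet R) : Type :=
  {z : X * fdist R X | TD_mem r z.1 z.2}.

Definition TD_obj (r : ennreal R) (X : epmet R) : epmet R :=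
  @EPMet R (TD_carrier r X) (fun z w => dist (sval z).1 (sval w).1)
    (fun _ _ => dist_ge0 _ _) (fun _ => dist_refl _)
    (fun _ _ => dist_sym _ _) (fun _ _ _ => dist_triangle _ _ _).

Lemma TD_mem_map (r : ennreal R) (X Y : epmet R) (f : nonexp X Y)
    (x : X) (p : fdist R X) :
  TD_mem r x p -> TD_mem r (f x) (fd_map f p).
Proof.
rewrite /TD_mem; case: v.
- move=> pr b /=; apply: contra_neqP => nb; apply: fsbig1 => a /= fab.
  apply: contrapT => /eqP /pr xa; apply: nb; rewrite -fab.
  exact: le_trans (nx_le f x a) xa.
- move=> [a [pa xa]]; exists (f a); split; last first.
    exact: le_trans (nx_le f x a) xa.
  pose A : set {classic X} := f @^-1` [set f a].
  pose Sp : set {classic X} := [set x | p x != 0].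
  rewrite gt_eqF //= /map_mass -(fsbig_widen (A `&` Sp)); last 2 first.
  + by move=> y [].
  + by move=> y [fy ny] /=; apply: contrapT => /eqP py; exact: ny.
  rewrite (fsbigD1 (a : {classic X})) //=; last first.
    by apply: finite_setIr; exact: fd_finite.
  rewrite ltr_wpDr //; first by apply: fsumr_ge0 => y _; exact: fd_ge0.
  by rewrite lt0r pa fd_ge0.
- rewrite fd_expect_map; last by move=> y; exact: dist_ge0.
  apply: le_trans; rewrite /fd_expect.
  pose Sp : set {classic X} := [set x | p x != 0].
  have supp (F : X -> \bar R) :
      (\sum_(x \in [set: {classic X}]) (p x)%:E * F x =
       \sum_(x \in Sp) (p x)%:E * F x)%E.
    apply/esym/fsbig_widen => // y [_ /= /negP]; rewrite negbK => /eqP ->.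
    by rewrite mul0e.
  rewrite !supp; apply: lee_fsum => [|y _]; first exact: fd_finite.
  by apply: lee_wpmul2l; [rewrite lee_fin fd_ge0|exact: nx_le].
Qed.

Definition TD_fun (r : ennreal R) (X Y : epmet R) (f : nonexp X Y)
    (z : TD_carrier r X) : TD_carrier r Y :=
  exist (fun w : Y * fdist R Y => TD_mem r w.1 w.2)
    (f (sval z).1, fd_map f (sval z).2) (TD_mem_map f (svalP z)).

Definition TD_map (r : ennreal R) (X Y : epmet R) (f : nonexp X Y) :
    nonexp (TD_obj r X) (TD_obj r Y) :=
  @NonExp R (TD_obj r X) (TD_obj r Y) (@TD_fun r X Y f)
    (fun z w => nx_le f (sval z).1 (sval w).1).

Lemma TD_carrier_eq (r : ennreal R) (X : epmet R) (z w : TD_carrier r X) :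
  sval z = sval w -> z = w.
Proof.
by case: z w => [z hz] [w hw] /= zw; exact: eq_exist.
Qed.

Let TD_map_id r X : @TD_map r X X (nonexp_id X) = nonexp_id (TD_obj r X).
Proof.
apply: nonexp_eq => -[[x p] hp]; apply: TD_carrier_eq => /=.
by rewrite fd_map_id.
Qed.

Let TD_map_comp r X Y Z (g : nonexp Y Z) (f : nonexp X Y) :
  TD_map r (nonexp_comp g f) = nonexp_comp (TD_map r g) (TD_map r f).
Proof.
apply: nonexp_eq => -[[x p] hp]; apply: TD_carrier_eq => /=.
by rewrite -fd_map_comp.
Qed.

Definition TD (r : ennreal_monoid R) : functor (Met R) (Met R) :=
  @Functor (Met R) (Met R) (TD_obj r) (@TD_map r)
    (@TD_map_id r) (@TD_map_comp r).

Definition TD_pi2 (r : ennreal R) (X : epmet R) (z : TD_obj r X) : fdist R X :=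
  (sval z).2.

End TD.

(* Main.v *)
Require Import Defs.
From mathcomp Require Import all_boot all_order all_algebra.
From mathcomp Require Import all_classical all_reals ereal.

(** A finitely supported distribution is determined by its expectation
    functional on nonnegative functions. Under this functional the unit becomes
    evaluation, pushforward becomes precomposition and flattening becomes the
    iterated expectation, so the distribution parts of the graded monad laws
    hold by rewriting. That multiplication adds grades is the triangle inequality
    through the middle point, applied pointwise on supports for the worst and
    best cases and integrated for the expected value. *)

Set Implicit Arguments.
Unset Strict Implicit.
Unset Printing Implicit Defensive.

Import Order.TTheory GRing.Theory Num.Theory.

(** * Expectation calculus for finitely supported distributions *)

Section Expectation.
Local Open Scope classical_set_scope.
Local Open Scope ring_scope.
Variable R : realType.

(** Terms off the support vanish even where [F] is infinite, since [0 * +oo = 0]. Applied with a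
    finite [S], this gives a sum that can be split, compared or exchanged with another. *)
Lemma fd_expect_widen (X : Type) (p : fdist R X) (S : set {classic X})
    (F : X -> \bar R) :
  (forall x, p x != 0 -> S x) ->
  fd_expect p F = (\sum_(x \in S) (p x)%:E * F x)%E.
Proof.
move=> pS; apply/esym/fsbig_widen => // x [_ /= nSx].
have [->|/pS//] := eqVneq (p x) 0.
by rewrite mul0e.
Qed.

Lemma fd_expect_ge0 (X : Type) (p : fdist R X) (F : X -> \bar R) :
  (forall x, 0 <= F x)%E -> (0 <= fd_expect p F)%E.
Proof.
by move=> F0; apply: fsume_ge0 => x _; rewrite mule_ge0 ?lee_fin ?fd_ge0.
Qed.

Lemma eq_fd_expect (X : Type) (p : fdist R X) (F G : X -> \bar R) :
  (forall x, F x = G x) -> fd_expect p F = fd_expect p G.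
Proof. by move=> FG; apply: eq_fsbigr => x _; rewrite FG. Qed.

Lemma le_fd_expect (X : Type) (p : fdist R X) (F G : X -> \bar R) :
  (forall x, F x <= G x)%E -> (fd_expect p F <= fd_expect p G)%E.
Proof.
move=> FG; rewrite !(@fd_expect_widen _ p [set x | p x != 0])//.
apply: lee_fsum => [|x _]; first exact: fd_finite.
by rewrite lee_wpmul2l ?lee_fin ?fd_ge0.
Qed.

Lemma fd_expectD (X : Type) (p : fdist R X) (F G : X -> \bar R) :
  (forall x, 0 <= F x)%E -> (forall x, 0 <= G x)%E ->
  fd_expect p (fun x => F x + G x)%E = (fd_expect p F + fd_expect p G)%E.
Proof.
move=> F0 G0; rewrite !(@fd_expect_widen _ p [set x | p x != 0])//.
rewrite -fsbig_split; last exact: fd_finite.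
by apply: eq_fsbigr => x _; rewrite ge0_muleDr.
Qed.

Lemma fd_expect_cst (X : Type) (p : fdist R X) (c : \bar R) :
  fd_expect p (fun=> c) = c.
Proof.
rewrite (@fd_expect_widen _ p [set x | p x != 0])//.
(* Because the masses are nonnegative, [c] factors out even when it is infinite. *)
rewrite -ge0_mule_fsuml; last by move=> x; rewrite lee_fin fd_ge0.
rewrite fsumEFin; last exact: fd_finite.
rewrite (@fsbig_widen _ _ _ _ _ setT)// ?fd_sum1 ?mul1e// => x [_ /= /negP].
by rewrite negbK => /eqP.
Qed.

Lemma fd_unit_support (X : Type) (x y : X) : fd_unit R x y != 0 <-> y = x.
Proof.
rewrite /= /unit_mass pnatr_eq0 eqb0 negbK.
by split=> [/eqP//|->]; exact: eqxx.
Qed.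

Lemma fd_expect_unit (X : Type) (x : X) (F : X -> \bar R) :
  fd_expect (fd_unit R x) F = F x.
Proof.
rewrite (@fd_expect_widen _ _ [set (x : {classic X})]); last first.
  by move=> y /fd_unit_support.
by rewrite fsbig_set1 /= /unit_mass eqxx mul1e.
Qed.

(** The two sums are exchanged after being cut down to finite sets: the support [SP] of [P], and the
    union [S] of the supports of the members of [SP]. The set [S] contains the support of the
    flattening and that of each [p] in [SP], so one index set serves both sides. *)
Lemma fd_expect_join (X : Type) (P : fdist R (fdist R X)) (F : X -> \bar R) :
  (forall x, 0 <= F x)%E ->
  fd_expect (fd_join P) F = fd_expect P (fun p => fd_expect p F).
Proof.
move=> F0.
pose SP : set {classic fdist R X} := [set p | P p != 0].
pose S : set {classic X} := \bigcup_(p in SP) [set x | p x != 0].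
have SPfin : finite_set SP by exact: fd_finite.
have Sfin : finite_set S by apply: bigcup_finite => // p _; exact: fd_finite.
have joinE x : fd_join P x = \sum_(p \in SP) P p * (p : fdist R X) x.
  apply/esym/fsbig_widen => // p [_ /= /negP]; rewrite negbK => /eqP ->.
  by rewrite mul0r.
rewrite (@fd_expect_widen _ _ S); last first.
  move=> x; apply: contra_neqP => nSx; rewrite joinE; apply: fsbig1 => p Pp.
  have [->|px] := eqVneq (p x) 0; first by rewrite mulr0.
  by case: nSx; exists p.
under eq_fsbigr => x _.
  rewrite joinE -fsumEFin // ge0_mule_fsuml; last first.
    by move=> p; rewrite lee_fin mulr_ge0 ?fd_ge0.
  over.
rewrite exchange_fsbig // (@fd_expect_widen _ P SP)//.
apply: eq_fsbigr => p; rewrite inE => Pp.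
rewrite (@fd_expect_widen _ p S); last by move=> x px; exists p.
rewrite ge0_mule_fsumr; last by move=> x; rewrite mule_ge0 ?lee_fin ?fd_ge0.
by apply: eq_fsbigr => x _; rewrite EFinM muleA.
Qed.

(** Nonnegative terms cannot cancel. This is how supports are read off from expectations below. *)
Lemma fd_expect_neq0 (X : Type) (p : fdist R X) (F : X -> \bar R) :
  (forall x, 0 <= F x)%E ->
  fd_expect p F != 0%E <-> exists x, p x != 0 /\ F x != 0%E.
Proof.
move=> F0; rewrite (@fd_expect_widen _ p [set x | p x != 0])//; split.
  apply: contra_neqP => nF; apply: fsbig1 => x /= px.
  have [->|Fx] := eqVneq (F x) 0%E; first by rewrite mule0.
  by case: nF; exists x.
move=> [x [px Fx]]; apply/eqP => /pfsume_eq0 H.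
have /eqP : ((p x)%:E * F x = 0)%E.
  apply: H => // [|y _]; first exact: fd_finite.
  by rewrite mule_ge0 ?lee_fin ?fd_ge0.
by rewrite mule_eq0 eqe (negbTE px) (negbTE Fx).
Qed.

(** Indicator of the point [x], with equality decided classically. These functions already separate
    distributions. *)
Definition fd_point (X : Type) (x y : X) : \bar R :=
  ((y == x :> {classic X})%:R)%:E.

Lemma fd_point_ge0 (X : Type) (x y : X) : (0 <= fd_point x y)%E.
Proof. by rewrite lee_fin ler0n. Qed.

Lemma fd_expect_point (X : Type) (p : fdist R X) (x : X) :
  fd_expect p (fd_point x) = (p x)%:E.
Proof.
rewrite /fd_expect -(fsbig_widen [set (x : {classic X})])//.
  by rewrite fsbig_set1 /fd_point eqxx mule1.
by move=> y [_ /= yx]; rewrite /fd_point; case: eqP => // _; rewrite mule0.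
Qed.

Lemma fdist_expect_eq (X : Type) (p q : fdist R X) :
  (forall F, (forall x, 0 <= F x)%E -> fd_expect p F = fd_expect q F) -> p = q.
Proof.
move=> pq; apply: fdist_eq => x; apply: EFin_inj.
by rewrite -!fd_expect_point pq// => y; exact: fd_point_ge0.
Qed.

(** The mass at [y] is the expectation under [p] of the indicator of the fibre over [y], so
    [fd_expect_neq0] applies. *)
Lemma fd_map_support (X Y : Type) (f : X -> Y) (p : fdist R X) (y : Y) :
  fd_map f p y != 0 <-> exists x, p x != 0 /\ f x = y.
Proof.
have -> : (fd_map f p y != 0) = (fd_expect p (fun x => fd_point y (f x)) != 0%E).
  by rewrite -fd_expect_map ?fd_expect_point// => z; exact: fd_point_ge0.
rewrite fd_expect_neq0; last by move=> x; exact: fd_point_ge0.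
split=> -[x [px fxy]]; exists x; split=> //.
  by move: fxy; rewrite /fd_point eqe pnatr_eq0 eqb0 negbK => /eqP.
by rewrite fxy /fd_point eqxx eqe oner_eq0.
Qed.

(** The mass at [x] is the expectation under [P] of the nonnegative function sending [p] to
    [p x]. *)
Lemma fd_join_support (X : Type) (P : fdist R (fdist R X)) (x : X) :
  fd_join P x != 0 <-> exists p : fdist R X, P p != 0 /\ p x != 0.
Proof.
have -> : (fd_join P x != 0) = (fd_expect P (fun p => (p x)%:E) != 0%E).
  rewrite -(eq_fd_expect P (fun p => fd_expect_point p x)) -fd_expect_join.
    by rewrite fd_expect_point.
  by move=> y; exact: fd_point_ge0.
by rewrite fd_expect_neq0// => p; rewrite lee_fin fd_ge0.
Qed.

(** * Monad laws of finite distributions, tested on expectations *)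

Lemma fd_map_unit (X Y : Type) (f : X -> Y) (x : X) :
  fd_map f (fd_unit R x) = fd_unit R (f x).
Proof.
by apply: fdist_expect_eq => F F0; rewrite fd_expect_map// !fd_expect_unit.
Qed.

Lemma fd_join_unit (X : Type) (p : fdist R X) : fd_join (fd_unit R p) = p.
Proof.
by apply: fdist_expect_eq => F F0; rewrite fd_expect_join// fd_expect_unit.
Qed.

Lemma fd_join_map_unit (X : Type) (p : fdist R X) :
  fd_join (fd_map (@fd_unit R X) p) = p.
Proof.
apply: fdist_expect_eq => F F0; rewrite fd_expect_join// fd_expect_map.
  by apply: eq_fd_expect => x; rewrite fd_expect_unit.
by move=> q; exact: fd_expect_ge0.
Qed.

Lemma fd_map_join (X Y : Type) (f : X -> Y) (P : fdist R (fdist R X)) :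
  fd_map f (fd_join P) = fd_join (fd_map (fd_map f) P).
Proof.
apply: fdist_expect_eq => F F0; rewrite fd_expect_map// !fd_expect_join//.
rewrite fd_expect_map; last by move=> q; exact: fd_expect_ge0.
by apply: eq_fd_expect => p; rewrite fd_expect_map.
Qed.

Lemma fd_join_join (X : Type) (Q : fdist R (fdist R (fdist R X))) :
  fd_join (fd_map (@fd_join R X) Q) = fd_join (fd_join Q).
Proof.
apply: fdist_expect_eq => F F0; have E0 q := fd_expect_ge0 q F0.
rewrite !fd_expect_join// fd_expect_map//.
by apply: eq_fd_expect => P; rewrite fd_expect_join.
Qed.

End Expectation.

(** * Membership conditions under inclusion, unit and multiplication *)

Section GradedMonad.
(* MathComp rebinds [hom] and [fmap]. *)
Import Defs.
Local Open Scope ring_scope.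
Variable R : realType.

Lemma TD_mem_sub (v : TD_variant) (q r : ennreal R) (X : epmet R) (x : X)
    (p : fdist R X) :
  ennreal_le q r -> TD_mem v q x p -> TD_mem v r x p.
Proof.
rewrite /ennreal_le /TD_mem => qr; case: v.
- by move=> h a /h /le_trans; exact.
- by move=> [a [pa xa]]; exists a; split=> //; exact: le_trans xa qr.
- by move=> /le_trans; exact.
Qed.

Lemma TD_mem_unit (v : TD_variant) (X : epmet R) (x : X) :
  TD_mem v (ennreal_zero R) x (fd_unit R x).
Proof.
rewrite /TD_mem; case: v.
- by move=> a /fd_unit_support ->; rewrite dist_refl.
- by exists x; rewrite dist_refl; split=> //; apply/fd_unit_support.
- by rewrite fd_expect_unit dist_refl.
Qed.

Lemma TD_join_support (v : TD_variant) (r : ennreal R) (X : epmet R)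
    (P : fdist R (TD_obj v r X)) (a : X) :
  fd_join (fd_map (@TD_pi2 R v r X) P) a != 0 <->
  exists u, P u != 0 /\ (sval u).2 a != 0.
Proof.
rewrite fd_join_support; split=> [[p [/fd_map_support[u [Pu <-]] pa]]|].
  by exists u.
move=> [u [Pu ua]]; exists (sval u).2; split=> //.
by apply/fd_map_support; exists u.
Qed.

Lemma TD_mem_join (v : TD_variant) (q r : ennreal R) (X : epmet R)
    (w : TD_obj v r X) (P : fdist R (TD_obj v r X)) :
  TD_mem v q w P ->
  TD_mem v (ennreal_add q r) (sval w).1
    (fd_join (fd_map (@TD_pi2 R v r X) P)).
Proof.
(* The middle point is the base point of [u]: by definition [dist w u] is the distance between the
   base points of [w] and [u]. *)
have tri (u : TD_obj v r X) a :
    (dist (sval w).1 a <= dist w u + dist (sval u).1 a)%E.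
  exact: dist_triangle.
case: v w P tri => w P tri; rewrite /TD_mem => wP.
- move=> a /TD_join_support[u [Pu ua]]; apply: le_trans (tri u a) _.
  by apply: leeD; [exact: wP|exact: (svalP u)].
(* Two witnesses are chained: a close [u] in the support of [P], then a point [a] of the
   distribution of [u] close to the base point of [u]. *)
- case: wP => u [Pu wu]; case: (svalP u) => a [ua da].
  exists a; split; first by apply/TD_join_support; exists u.
  by apply: le_trans (tri u a) _; exact: leeD.
- have d0 (Y : epmet R) (y z : Y) : (0 <= dist y z)%E by exact: dist_ge0.
  rewrite fd_expect_join// fd_expect_map; last first.
    by move=> p; exact: fd_expect_ge0.
  (* For fixed [u], averaging the triangle inequality over [a] leaves [dist w u] unchanged, as the
     total mass is 1, and membership of [u] bounds the other term by [r]. Averaging over [u] then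
     keeps [r] and bounds the mean of [dist w u] by [q]. *)
  apply: (@le_trans _ _ (fd_expect P (fun u => dist w u + val r)%E)).
    apply: le_fd_expect => u.
    apply: le_trans (le_fd_expect (sval u).2 (tri u)) _.
    rewrite fd_expectD// fd_expect_cst; apply: leeD => //.
    exact: (svalP u).
  rewrite fd_expectD// ?fd_expect_cst; last by move=> _; exact: (valP r).
  exact: leeD.
Qed.

(** * Structure maps and the graded monad laws *)

Variable v : TD_variant.

Local Notation TD := (@TD R v).
Local Notation TD_obj := (@TD_obj R v).

Definition TD_sub_fun (q r : ennreal R) (qr : ennreal_le q r) (X : epmet R)
    (z : TD_obj q X) : TD_obj r X :=
  exist (fun w : X * fdist R X => TD_mem v r w.1 w.2)
    (sval z) (TD_mem_sub qr (svalP z)).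

(** The metric sees only base points, which the inclusion preserves, so nonexpansiveness is
    reflexivity of the order. The same holds for the unit and the multiplication below. *)
Definition TD_sub_mor (q r : ennreal_monoid R) (qr : pm_le q r) (X : Met R) :
    hom (TD q X) (TD r X) :=
  @NonExp R (TD_obj q X) (TD_obj r X) (@TD_sub_fun q r qr X)
    (fun z w => lexx (dist z w)).

Definition TD_eta_fun (X : epmet R) (x : X) : TD_obj (ennreal_zero R) X :=
  exist (fun w : X * fdist R X => TD_mem v (ennreal_zero R) w.1 w.2)
    (x, fd_unit R x) (TD_mem_unit v x).

Definition TD_eta_mor (X : Met R) : hom X (TD pm_zero X) :=
  @NonExp R X (TD_obj (ennreal_zero R) X) (@TD_eta_fun X)
    (fun x y => lexx (dist x y)).

Definition TD_mu_fun (q r : ennreal R) (X : epmet R)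
    (z : TD_obj q (TD_obj r X)) : TD_obj (ennreal_add q r) X :=
  exist (fun w : X * fdist R X => TD_mem v (ennreal_add q r) w.1 w.2)
    ((sval (sval z).1).1, fd_join (fd_map (@TD_pi2 R v r X) (sval z).2))
    (TD_mem_join (svalP z)).

Definition TD_mu_mor (q r : ennreal_monoid R) (X : Met R) :
    hom (TD q (TD r X)) (TD (pm_add q r) X) :=
  @NonExp R (TD_obj q (TD_obj r X)) (TD_obj (ennreal_add q r) X)
    (@TD_mu_fun q r X) (fun z w => lexx (dist z w)).

Lemma TD_sub_natural (q r : ennreal_monoid R) (qr : pm_le q r) (X Y : Met R)
    (f : hom X Y) :
  (TD_sub_mor qr Y \o fmap (TD q) f = fmap (TD r) f \o TD_sub_mor qr X)%cat.
Proof. by apply: nonexp_eq => z; exact: TD_carrier_eq. Qed.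

Lemma TD_eta_natural (X Y : Met R) (f : hom X Y) :
  (TD_eta_mor Y \o f = fmap (TD pm_zero) f \o TD_eta_mor X)%cat.
Proof.
by apply: nonexp_eq => x; apply: TD_carrier_eq; rewrite /= fd_map_unit.
Qed.

Lemma TD_mu_natural (q r : ennreal_monoid R) (X Y : Met R) (f : hom X Y) :
  (TD_mu_mor q r Y \o fmap (functor_comp (TD q) (TD r)) f =
   fmap (TD (pm_add q r)) f \o TD_mu_mor q r X)%cat.
Proof.
apply: nonexp_eq => z; apply: TD_carrier_eq => /=; congr pair.
(* Once pushforwards are merged, both sides push forward along convertible functions: [TD_pi2] after
   the action of [f] computes to [fd_map f] after [TD_pi2]. *)
by rewrite fd_map_join -!fd_map_comp.
Qed.

(** All grades carve their carriers out of the same type of pairs, so transport along an equality of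
    grades affects only the membership proof. The monad laws can thus be checked on pairs. *)
Lemma sval_grade_cast (q r : ennreal_monoid R) (e : q = r) (X : Met R)
    (z : TD_obj q X) :
  sval (nx_fun (grade_cast TD e X) z) = sval z.
Proof. by case: _ / e. Qed.

Lemma TD_mu_sub (q q' r r' : ennreal_monoid R) (hq : pm_le q q')
    (hr : pm_le r r') (X : Met R) :
  (TD_mu_mor q' r' X \o
     (TD_sub_mor hq (TD r' X) \o fmap (TD q) (TD_sub_mor hr X)) =
   TD_sub_mor (pm_le_add hq hr) X \o TD_mu_mor q r X)%cat.
Proof.
apply: nonexp_eq => z; apply: TD_carrier_eq => /=; congr pair.
by rewrite -fd_map_comp.
Qed.

Lemma TD_mu_eta_l (r : ennreal_monoid R) (X : Met R) :
  (grade_cast TD (pm_add0l r) X \o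
     (TD_mu_mor pm_zero r X \o TD_eta_mor (TD r X)) =
   idm (TD r X))%cat.
Proof.
apply: nonexp_eq => z; apply: TD_carrier_eq.
rewrite [LHS]sval_grade_cast /= fd_map_unit fd_join_unit.
by rewrite /TD_pi2; case: (sval z).
Qed.

Lemma TD_mu_eta_r (r : ennreal_monoid R) (X : Met R) :
  (grade_cast TD (pm_add0r r) X \o
     (TD_mu_mor r pm_zero X \o fmap (TD r) (TD_eta_mor X)) =
   idm (TD r X))%cat.
Proof.
apply: nonexp_eq => z; apply: TD_carrier_eq.
(* The merged function, [TD_pi2] after the unit, is [fd_unit] up to conversion; the explicit pattern
   lets the unit law match it. *)
rewrite [LHS]sval_grade_cast /= -fd_map_comp [fd_join _]fd_join_map_unit.
by case: (sval z).
Qed.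

Lemma TD_mu_assoc (p q r : ennreal_monoid R) (X : Met R) :
  (grade_cast TD (pm_addA p q r) X \o
     (TD_mu_mor p (pm_add q r) X \o fmap (TD p) (TD_mu_mor q r X)) =
   TD_mu_mor (pm_add p q) r X \o TD_mu_mor p q (TD r X))%cat.
Proof.
apply: nonexp_eq => z; apply: TD_carrier_eq.
rewrite [LHS]sval_grade_cast /=; congr pair.
(* On the right, the outer [TD_pi2] moves inside the flattening and the two flattenings are
   reassociated. The merged function is then [TD_pi2] after the multiplication, as on the left. *)
by rewrite fd_map_join -fd_join_join -!fd_map_comp.
Qed.

Definition TD_sub (q r : ennreal_monoid R) (qr : pm_le q r) :
    nat_trans (TD q) (TD r) :=
  @NatTrans _ _ (TD q) (TD r) (TD_sub_mor qr) (TD_sub_natural qr).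

Definition TD_eta : nat_trans (functor_id (Met R)) (TD pm_zero) :=
  @NatTrans _ _ (functor_id (Met R)) (TD pm_zero) TD_eta_mor TD_eta_natural.

Definition TD_mu (q r : ennreal_monoid R) :
    nat_trans (functor_comp (TD q) (TD r)) (TD (pm_add q r)) :=
  @NatTrans _ _ (functor_comp (TD q) (TD r)) (TD (pm_add q r))
    (TD_mu_mor q r) (@TD_mu_natural q r).

Lemma TD_sub_refl (q : ennreal_monoid R) (h : pm_le q q) (X : Met R) :
  TD_sub h X = idm (TD q X).
Proof. by apply: nonexp_eq => z; exact: TD_carrier_eq. Qed.

Lemma TD_sub_trans (p q r : ennreal_monoid R) (hpq : pm_le p q)
    (hqr : pm_le q r) (hpr : pm_le p r) (X : Met R) :
  (TD_sub hqr X \o TD_sub hpq X = TD_sub hpr X)%cat.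
Proof. by apply: nonexp_eq => z; exact: TD_carrier_eq. Qed.

Definition TD_graded_monad : graded_monad TD :=
  @GradedMonad _ _ TD TD_sub TD_eta TD_mu TD_sub_refl TD_sub_trans
    TD_mu_sub TD_mu_eta_l TD_mu_eta_r TD_mu_assoc.

End GradedMonad.

Theorem theorem7p8 (R : realType) (v : TD_variant) :
  exists M : graded_monad (@TD R v),
    [/\ forall (q r : ennreal_monoid R) (h : pm_le q r) (X : epmet R)
          (z : TD_obj v q X),
          sval (nx_fun (gm_sub M h X) z) = sval z,
        forall (X : epmet R) (x : X),
          sval (nx_fun (gm_eta M X) x) = (x, fd_unit R x)
      & forall (q r : ennreal_monoid R) (X : epmet R)
          (z : TD_obj v q (TD_obj v r X)),
          sval (nx_fun (gm_mu M q r X) z) =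
          ((sval (sval z).1).1,
           fd_join (fd_map (@TD_pi2 R v r X) (sval z).2))].
Proof. by exists (TD_graded_monad R v); split. Qed.
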